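(* Let $\mathbb{K}$ be a field. For every integer $n\geq 4$ there exists a positively $\mathbb{Z}$-graded polynomial ring $S=\mathbb{K}[x_1,\ldots,x_n]$ in $n$ variables (with $\deg(x_i)=w_i$ for some positive integers $w_1,\dots,w_n$) for which the following assertion fails: ''the Veronese subring $S^{(e)}$ is nonstandard Koszul for all sufficiently large $e$''. That is, for this $S$ there are infinitely many integers $e\geq 1$ such that $S^{(e)}$ is not nonstandard Koszul.
   Context: For a positively $\mathbb{Z}$-graded $\mathbb{K}$-algebra $A=\bigoplus_{d\geq 0}A_d$ and an integer $e\geq 1$, the $e$-th Veronese subring is $A^{(e)}=\bigoplus_{k\geq 0}A_{ek}$. A standard $\mathbb{Z}$-graded $\mathbb{K}$-algebra $B$ (that is, $B_0=\mathbb{K}$ and $B$ is generated over $\mathbb{K}$ by a finite-dimensional $B_1$) is Koszul if the minimal graded $B$-free resolution of the residue field $\mathbb{K}=B/B_+$ is linear, i.e. $\operatorname{Tor}^B_i(\mathbb{K},\mathbb{K})_j=0$ whenever $i\neq j$. Let $A$ be a finitely generated positively $\mathbb{Z}$-graded $\mathbb{K}$-algebra with $A_0=\mathbb{K}$ and $\mathfrak{m}=A_+$ its homogeneous maximal ideal. $A$ is nonstandard Koszul if the associated graded ring $\operatorname{gr}_{\mathfrak{m}}(A)=\bigoplus_{k\geq 0}\mathfrak{m}^k/\mathfrak{m}^{k+1}$ is Koszul as a standard $\mathbb{Z}$-graded $\mathbb{K}$-algebra (graded by $k$). *)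

(* Defs.v *)
From HB Require Import structures.
From mathcomp Require Import all_boot all_algebra.
From mathcomp Require Import boolp.
From mathcomp Require Import mpoly.

Set Implicit Arguments.
Unset Strict Implicit.
Unset Printing Implicit Defensive.

Import GRing.Theory.
Local Open Scope ring_scope.

(* Finite sums of homogeneous elements whose degrees satisfy D. *)
Definition hsum (A : comNzRingType) (comp : nat -> A -> Prop) (D : pred nat)
    (a : A) : Prop :=
  exists2 s : seq A,
    forall x, x \in s -> exists2 d, D d & comp d x & a = \sum_(x <- s) x.

Record grading (A : comNzRingType) := Grading {
  gcomp : nat -> A -> Prop;
  gcomp0 : forall d, gcomp d 0;
  gcompB : forall d a b, gcomp d a -> gcomp d b -> gcomp d (a - b);
  gcomp1 : gcomp 0 1;
  gcompM : forall d e a b, gcomp d a -> gcomp e b -> gcomp (d + e)%N (a * b);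
  gcomp_span : forall a, hsum gcomp predT a;
  gcomp_indep : forall (r : seq nat) (f : nat -> A), uniq r ->
    (forall d, gcomp d (f d)) -> \sum_(d <- r) f d = 0 ->
    forall d, d \in r -> f d = 0
}.

Section HSum.
Variables (A : comNzRingType) (G : grading A).
Implicit Types (D : pred nat) (a b : A).

Lemma gcompN d a : gcomp G d a -> gcomp G d (- a).
Proof. by move=> ha; rewrite -sub0r; apply: gcompB => //; apply: gcomp0. Qed.

Lemma gcompD d a b : gcomp G d a -> gcomp G d b -> gcomp G d (a + b).
Proof. by move=> ha hb; rewrite -[b]opprK; apply: gcompB => //; apply: gcompN. Qed.

Lemma hsum0 D : hsum (gcomp G) D 0.
Proof. by exists [::]; rewrite ?big_nil. Qed.

Lemma hsumD D a b : hsum (gcomp G) D a -> hsum (gcomp G) D b ->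
  hsum (gcomp G) D (a + b).
Proof.
move=> [s hs ->] [t ht ->]; exists (s ++ t); last by rewrite big_cat.
by move=> x; rewrite mem_cat => /orP[/hs|/ht].
Qed.

Lemma hsumN D a : hsum (gcomp G) D a -> hsum (gcomp G) D (- a).
Proof.
move=> [s hs ->]; exists (map -%R s); last by rewrite big_map sumrN.
by move=> _ /mapP[x /hs[d Dd hd] ->]; exists d => //; apply: gcompN.
Qed.

Lemma hsumM D1 D2 D a b : (forall d e, D1 d -> D2 e -> D (d + e)%N) ->
  hsum (gcomp G) D1 a -> hsum (gcomp G) D2 b -> hsum (gcomp G) D (a * b).
Proof.
move=> hD [s hs ->] [t ht ->]; exists [seq x * y | x <- s, y <- t].
  move=> _ /allpairsP[[x y] [/= /hs[d Dd hd] /ht[e De he] ->]].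
  by exists (d + e)%N; [apply: hD | apply: gcompM].
rewrite big_allpairs_dep mulr_suml; apply: eq_bigr => x _.
by rewrite mulr_sumr.
Qed.

Lemma hsum_family D a : hsum (gcomp G) D a ->
  exists (r : seq nat) (f : nat -> A), [/\ uniq r, all D r,
    forall d, gcomp G d (f d), forall d, d \notin r -> f d = 0
    & a = \sum_(d <- r) f d].
Proof.
case=> s hs ->; elim: s hs => [|x s IHs] hs.
  exists [::], (fun=> 0); split=> // [d|]; first exact: gcomp0.
  by rewrite !big_nil.
case: IHs => [y ys|r [f [ur Dr hf f0 sE]]].
  by apply: hs; rewrite inE ys orbT.
have [d Dd hx] := hs x (mem_head _ _).
pose g e := f e + (if e == d then x else 0).
exists (if d \in r then r else d :: r), g; split.
- by case: ifP => //= ->.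
- by case: ifP => //= _; rewrite Dd.
- move=> e; rewrite /g; apply: gcompD => //.
  by case: eqP => [->|_] //; apply: gcomp0.
- move=> e er; rewrite /g; move: er; case: ifP => dr.
    move=> er; rewrite f0 // add0r; case: eqP er => // ->.
    by rewrite dr.
  by rewrite inE negb_or => /andP[/negPf -> er]; rewrite f0 // addr0.
rewrite big_cons sE; case: ifP => dr.
  rewrite big_split /= addrC; congr (_ + _).
  by rewrite -big_mkcond /= -big_filter filter_pred1_uniq // big_seq1.
rewrite big_cons {1}/g eqxx f0 ?dr // add0r; congr (_ + _).
rewrite !big_seq; apply: eq_bigr => e er; rewrite /g.
by case: eqP er => [->|]; rewrite ?dr // addr0.
Qed.

End HSum.

(* The ideal A_+. *)
Definition irrelevant (A : comNzRingType) (G : grading A) : pred A :=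
  fun a => `[< hsum (gcomp G) (fun d => 0 < d)%N a >].

Lemma irrelevantP (A : comNzRingType) (G : grading A) a :
  reflect (hsum (gcomp G) (fun d => 0 < d)%N a) (a \in irrelevant G).
Proof. exact: asboolP. Qed.

Lemma irrelevant_idealr (A : comNzRingType) (G : grading A) :
  idealr_closed (irrelevant G).
Proof.
split; first by apply/irrelevantP; apply: hsum0.
  apply/negP => /irrelevantP/hsum_family[r [f [ur Dr hf f0 e1]]].
  have r0 : 0%N \notin r by apply/negP => /(allP Dr).
  pose g d := if d == 0%N then -1 else f d.
  have hg d : gcomp G d (g d).
    rewrite /g; case: eqP => [->|//]; apply: gcompN; exact: gcomp1.
  have := gcomp_indep (r := 0%N :: r) _ hg; rewrite /= r0 ur big_cons.
  have -> : \sum_(d <- r) g d = 1.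
    rewrite e1 !big_seq; apply: eq_bigr => d dr; rewrite /g.
    by case: eqP dr r0 => // -> ->.
  rewrite /g eqxx addNr => /(_ isT erefl 0%N (mem_head _ _)) /eqP.
  by rewrite oppr_eq0 oner_eq0.
move=> a x y /irrelevantP hx /irrelevantP hy; apply/irrelevantP.
apply: hsumD hy; apply: hsumM (gcomp_span G a) hx => d e _.
by rewrite addn_gt0 => ->; rewrite orbT.
Qed.

HB.instance Definition _ (A : comNzRingType) (G : grading A) :=
  isIdealr.Build A (irrelevant G) (irrelevant_idealr G).

(* A^(e) as a subring of A: sums of homogeneous elements of degree in eN. *)
Definition veronese_pred (A : comNzRingType) (G : grading A) (e : nat) : pred A :=
  fun a => `[< hsum (gcomp G) (fun d => e %| d)%N a >].

Section Veronese.
Variables (A : comNzRingType) (G : grading A) (e : nat).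

Lemma veroneseP a :
  reflect (hsum (gcomp G) (fun d => e %| d)%N a) (a \in veronese_pred G e).
Proof. exact: asboolP. Qed.

Lemma veronese_subring : subring_closed (veronese_pred G e).
Proof.
split.
- apply/veroneseP; exists [:: 1]; last by rewrite big_seq1.
  by move=> x /[!inE]/eqP ->; exists 0%N; [rewrite dvdn0 | apply: gcomp1].
- move=> a b /veroneseP ha /veroneseP hb; apply/veroneseP.
  by apply: hsumD => //; apply: hsumN.
move=> a b /veroneseP ha /veroneseP hb; apply/veroneseP.
by apply: hsumM ha hb => c d; apply: dvdn_add.
Qed.

HB.instance Definition _ :=
  GRing.isSubringClosed.Build A (veronese_pred G e) veronese_subring.

Record veronese := Veronese {
  veronese_val :> A;
  veronese_valP : veronese_val \in veronese_pred G e
}.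

HB.instance Definition _ := [isSub for veronese_val].
HB.instance Definition _ := [Choice of veronese by <:].
HB.instance Definition _ := [SubChoice_isSubComNzRing of veronese by <:].

Definition veronese_comp (k : nat) (a : veronese) : Prop :=
  gcomp G (e * k)%N (val a).

Hypothesis e_gt0 : (0 < e)%N.

Lemma veronese_span a : hsum veronese_comp predT a.
Proof.
have [s hs aE] := veroneseP _ (valP a).
have sV x : x \in s -> x \in veronese_pred G e.
  move=> /hs[d ed hd]; apply/veroneseP; exists [:: x]; last by rewrite big_seq1.
  by move=> y /[!inE]/eqP ->; exists d.
exists (pmap insub s).
  move=> x; rewrite mem_pmap_sub => /hs[d /dvdnP[k ->] hd]; exists k => //.
  by rewrite /veronese_comp mulnC.
apply: val_inj; rewrite aE raddf_sum /=.
elim: s sV {hs aE} => [|x s IHs] sV; first by rewrite !big_nil.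
have xV := sV x (mem_head _ _).
rewrite /= insubT /= !big_cons IHs // => y ys.
by apply: sV; rewrite inE ys orbT.
Qed.

Lemma veronese_indep (r : seq nat) (f : nat -> veronese) : uniq r ->
  (forall d, veronese_comp d (f d)) -> \sum_(d <- r) f d = 0 ->
  forall d, d \in r -> f d = 0.
Proof.
move=> ur hf sf d dr; apply: val_inj.
pose g c : A := if (e %| c)%N then val (f (c %/ e)%N) else 0.
have gE k : g (e * k)%N = val (f k) by rewrite /g dvdn_mulr // mulKn.
rewrite -gE; apply: (gcomp_indep (g := G) (r := [seq e * k | k <- r]%N)).
- rewrite map_inj_uniq // => k l /eqP; rewrite eqn_pmul2l //; exact: eqP.
- move=> c; rewrite /g; case: ifP => [/dvdnP[k ->]|_]; last exact: gcomp0.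
  by rewrite mulnK // mulnC; apply: hf.
- rewrite big_map (eq_bigr (fun k => val (f k))) => [|k _]; last exact: gE.
  by rewrite -raddf_sum sf.
exact: map_f.
Qed.

Definition veronese_grading : grading veronese.
Proof.
apply: (@Grading _ veronese_comp).
- by move=> d; apply: gcomp0.
- by move=> d a b; apply: gcompB.
- by rewrite /veronese_comp muln0; apply: gcomp1.
- by move=> c d a b; rewrite /veronese_comp mulnDr; apply: gcompM.
- exact: veronese_span.
- exact: veronese_indep.
Defined.

End Veronese.

Section IdealPow.
Variable A : comNzRingType.
Implicit Types I J : A -> Prop.

Definition ideal_mul I J (a : A) : Prop :=
  exists2 s : seq (A * A),
    forall xy, xy \in s -> I xy.1 /\ J xy.2 & a = \sum_(xy <- s) xy.1 * xy.2.

Fixpoint ideal_pow I (k : nat) : A -> Prop :=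
  if k is k'.+1 then ideal_mul I (ideal_pow I k') else fun=> True.

Lemma ideal_pow0 I k : ideal_pow I k 0.
Proof. by case: k => //= k; exists [::]; rewrite ?big_nil. Qed.

Lemma ideal_powD I k a b :
  ideal_pow I k a -> ideal_pow I k b -> ideal_pow I k (a + b).
Proof.
case: k => //= k [s hs ->] [t ht ->]; exists (s ++ t); last by rewrite big_cat.
by move=> x; rewrite mem_cat => /orP[/hs|/ht].
Qed.

Lemma ideal_pow_sum I k (T : eqType) (s : seq T) (F : T -> A) :
  (forall x, x \in s -> ideal_pow I k (F x)) -> ideal_pow I k (\sum_(x <- s) F x).
Proof.
move=> h; rewrite big_seq; apply: (big_ind (ideal_pow I k)) => //.
  exact: ideal_pow0.
exact: ideal_powD.
Qed.

Lemma ideal_powMl I k a b : ideal_pow I k b -> ideal_pow I k (a * b).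
Proof.
elim: k a b => //= k IHk a _ [s hs ->].
exists [seq (xy.1, a * xy.2) | xy <- s].
  by move=> _ /mapP[xy /hs[h1 h2] ->]; split=> //; apply: IHk.
by rewrite big_map mulr_sumr; apply: eq_bigr => xy _ /=; rewrite mulrCA.
Qed.

Lemma ideal_powB I k a b :
  ideal_pow I k a -> ideal_pow I k b -> ideal_pow I k (a - b).
Proof.
by move=> ha hb; apply: ideal_powD => //; rewrite -mulN1r; apply: ideal_powMl.
Qed.

Lemma ideal_powM I j k a b :
  ideal_pow I j a -> ideal_pow I k b -> ideal_pow I (j + k) (a * b).
Proof.
elim: j a => [|j IHj] a; first by move=> _; apply: ideal_powMl.
move=> [s hs ->] hb; rewrite addSn; exists [seq (xy.1, xy.2 * b) | xy <- s].
  by move=> _ /mapP[xy /hs[h1 h2] ->]; split=> //; apply: IHj.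
by rewrite big_map mulr_suml; apply: eq_bigr => xy _ /=; rewrite mulrA.
Qed.

End IdealPow.

(* gr_I(A) is the quotient of the Rees algebra (+)_k I^k t^k, a subring of A[t],
   by its ideal (+)_k I^(k+1) t^k. *)
Section AssociatedGraded.
Variables (A : comNzRingType) (I : idealr A).

Local Notation Ipow := (ideal_pow (fun x => x \in I)).

Definition rees_pred : pred {poly A} :=
  fun p => `[< forall k, Ipow k p`_k >].

Lemma reesP (p : {poly A}) : reflect (forall k, Ipow k p`_k) (p \in rees_pred).
Proof. exact: asboolP. Qed.

Lemma rees_subring : subring_closed rees_pred.
Proof.
split.
- by apply/reesP => -[|k] //; rewrite coef1; apply: ideal_pow0.
- move=> p q /reesP hp /reesP hq; apply/reesP => k; rewrite coefB.
  exact: ideal_powB.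
move=> p q /reesP hp /reesP hq; apply/reesP => k; rewrite coefM.
apply: ideal_pow_sum => j _; have jk : (j <= k)%N by rewrite -ltnS.
by have := ideal_powM (hp j) (hq (k - j)%N); rewrite subnKC.
Qed.

HB.instance Definition _ :=
  GRing.isSubringClosed.Build {poly A} rees_pred rees_subring.

Record rees := Rees {
  rees_val :> {poly A};
  rees_valP : rees_val \in rees_pred
}.

HB.instance Definition _ := [isSub for rees_val].
HB.instance Definition _ := [Choice of rees by <:].
HB.instance Definition _ := [SubChoice_isSubComNzRing of rees by <:].

Definition rees_ideal : pred rees :=
  fun p => `[< forall k, Ipow k.+1 (rees_val p)`_k >].

Lemma rees_idealP p :
  reflect (forall k, Ipow k.+1 (rees_val p)`_k) (p \in rees_ideal).
Proof. exact: asboolP. Qed.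

Lemma rees_idealr : idealr_closed rees_ideal.
Proof.
split.
- by apply/rees_idealP => k; rewrite /= coef0; apply: (ideal_pow0 _ k.+1).
- apply/negP => /rees_idealP /(_ 0%N); rewrite coef1 => -[s hs s1].
  suff : 1 \in I by rewrite idealr1.
  rewrite [1]s1 big_seq; apply: rpred_sum => xy /hs[h1 _].
  by rewrite mulrC; apply: idealMr.
move=> a p q /rees_idealP hp /rees_idealP hq; apply/rees_idealP => k.
rewrite [rees_val _]/= coefD; apply: ideal_powD => //; rewrite [rees_val _]/= coefM.
apply: ideal_pow_sum => j _; have jk : (j <= k)%N by rewrite -ltnS.
have := ideal_powM (reesP _ (rees_valP a) j) (hp (k - j)%N).
by rewrite addnS subnKC.
Qed.

HB.instance Definition _ := isIdealr.Build rees rees_ideal rees_idealr.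

Definition assoc_gr := {ideal_quot (rees_ideal : idealr rees)}.

HB.instance Definition _ := GRing.ComNzRing.on assoc_gr.

Definition gr_pi (p : rees) : assoc_gr := (\pi_assoc_gr p)%qT.

(* The component I^k/I^(k+1): classes of monomials a t^k. *)
Definition gr_comp (k : nat) (x : assoc_gr) : Prop :=
  exists2 p : rees,
    forall j, j != k -> (rees_val p)`_j = 0 & x = gr_pi p.

Lemma gr_pi_eq0 p : gr_pi p = 0 <-> p \in rees_ideal.
Proof.
have := Quotient.idealrBE (rees_ideal : idealr rees) p 0; rewrite subr0 => ->.
have -> : gr_pi p = 0 <-> gr_pi p = gr_pi 0 by rewrite /gr_pi rmorph0.
by split=> [/eqP|/eqP].
Qed.

Lemma rees_mono_subproof (p : rees) k : (rees_val p)`_k *: 'X^k \in rees_pred.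
Proof.
apply/reesP => j; rewrite coefZ coefXn; case: eqP => [->|_].
  by rewrite mulr1; apply: (reesP _ (rees_valP p)).
by rewrite mulr0; apply: ideal_pow0.
Qed.

Definition rees_mono p k := Rees (rees_mono_subproof p k).

Lemma gr_span x : hsum gr_comp predT x.
Proof.
have xE : x = gr_pi (repr x) by rewrite /gr_pi reprK.
set p := repr x in xE.
exists [seq gr_pi (rees_mono p k) | k <- index_iota 0 (size (rees_val p))].
  move=> _ /mapP[k _ ->]; exists k => //; exists (rees_mono p k) => // j /negPf jk.
  by rewrite /= coefZ coefXn jk mulr0.
rewrite big_map xE /gr_pi -rmorph_sum; congr (_ _).
apply: val_inj; rewrite raddf_sum /= big_mkord.
by rewrite -[LHS]coefK poly_def.
Qed.

Lemma gr_indep (r : seq nat) (f : nat -> assoc_gr) : uniq r ->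
  (forall d, gr_comp d (f d)) -> \sum_(d <- r) f d = 0 ->
  forall d, d \in r -> f d = 0.
Proof.
move=> ur hf sf d dr.
have /choice[P hP] c : exists p : rees,
    (forall j, j != c -> (rees_val p)`_j = 0) /\ f c = gr_pi p.
  by have [p hp ->] := hf c; exists p.
have [Pd ->] := hP d; apply/gr_pi_eq0.
move: sf; rewrite (eq_bigr (fun c => gr_pi (P c))) => [|c _]; last by case: (hP c).
rewrite /gr_pi -rmorph_sum => /gr_pi_eq0 /rees_idealP sI.
apply/rees_idealP => k; have [->|kd] := eqVneq k d; last first.
  by rewrite Pd //; apply: ideal_pow0.
have valE : rees_val (\sum_(c <- r) P c) = \sum_(c <- r) rees_val (P c).
  exact: (raddf_sum (val : rees -> {poly A})).
have := sI d; rewrite valE coef_sum (bigD1_seq d) //= big1 ?addr0 //.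
by move=> c cd; have [-> //] := hP c; rewrite eq_sym.
Qed.

Definition gr_grading : grading assoc_gr.
Proof.
apply: (@Grading _ gr_comp).
- move=> d; exists 0; last by rewrite /gr_pi rmorph0.
  by move=> j _; rewrite /= coef0.
- move=> d _ _ [p hp ->] [q hq ->]; exists (p - q); last by rewrite /gr_pi rmorphB.
  by move=> j jd; rewrite /= coefB hp // hq // subr0.
- exists 1; last by rewrite /gr_pi rmorph1.
  by move=> j /negPf j0; rewrite /= coef1 j0.
- move=> d e _ _ [p hp ->] [q hq ->]; exists (p * q); last by rewrite /gr_pi rmorphM.
  move=> j jde; rewrite /= coefM big1 // => i _.
  case: (eqVneq (i : nat) d) => [id|/hp -> //]; last by rewrite mul0r.
  rewrite hq ?mulr0 //; apply: contraNneq jde => <-.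
  by rewrite -id subnKC // -ltnS.
- exact: gr_span.
- exact: gr_indep.
Defined.

End AssociatedGraded.

(* Graded free resolutions of B/B_+ (the residue field when B_0 is a field) by
   modules F_i = (+)_p B(- res_deg p) of finite
   rank.  Elements of F_i are row vectors, acted on by matrices on the right, and
   the augmentation F_0 -> B/B_+ is given by lifts to B of the images of the
   basis elements.  For B standard graded (hence Noetherian) the minimal graded
   free resolution is of this form, and it is unique up to isomorphism. *)
Record gfree_resolution (B : comNzRingType) (G : grading B) := GFreeResolution {
  res_rank : nat -> nat;
  res_deg : forall i, 'I_(res_rank i) -> nat;
  res_aug : 'cV[B]_(res_rank 0);
  res_diff : forall i, 'M[B]_(res_rank i.+1, res_rank i);
  res_aug_homog : forall p, gcomp G (res_deg p) (res_aug p 0);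
  res_diff_homog : forall i p q, res_diff i p q != 0 ->
    exists2 k, res_deg p = (res_deg q + k)%N & gcomp G k (res_diff i p q);
  res_aug_surj : forall b, exists v : 'rV_(res_rank 0),
    b - (v *m res_aug) 0 0 \in irrelevant G;
  res_aug_exact : forall v : 'rV_(res_rank 0),
    (v *m res_aug) 0 0 \in irrelevant G <-> exists u, v = u *m res_diff 0;
  res_diff_exact : forall i (v : 'rV_(res_rank i.+1)),
    v *m res_diff i = 0 <-> exists u, v = u *m res_diff i.+1
}.

Definition minimal_resolution (B : comNzRingType) (G : grading B)
    (F : gfree_resolution G) : Prop :=
  forall i p q, res_diff F i p q \in irrelevant G.

Definition linear_resolution (B : comNzRingType) (G : grading B)
    (F : gfree_resolution G) : Prop :=
  forall i (p : 'I_(res_rank F i)), res_deg p = i.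

Definition koszul (B : comNzRingType) (G : grading B) : Prop :=
  exists2 F : gfree_resolution G, minimal_resolution F & linear_resolution F.

(* The K-linear structure of A plays no role: being nonstandard Koszul only
   depends on the graded ring A. *)
Definition nonstandard_koszul (A : comNzRingType) (G : grading A) : Prop :=
  koszul (gr_grading (irrelevant G)).

Section WeightedPolynomials.
Variables (K : fieldType) (n : nat) (w : 'I_n -> nat).

Definition wdeg (m : 'X_{1..n}) : nat := \sum_(i < n) (m i * w i)%N.

Definition wcomp (d : nat) (p : {mpoly K[n]}) : Prop :=
  forall m, m \in msupp p -> wdeg m = d.

Lemma wdegD m1 m2 : wdeg (m1 + m2)%MM = (wdeg m1 + wdeg m2)%N.
Proof.
by rewrite /wdeg -big_split; apply: eq_bigr => i _; rewrite mnmDE mulnDl.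
Qed.

Lemma wcomp_span p : hsum wcomp predT p.
Proof.
exists [seq p@_m *: 'X_[m] | m <- msupp p]; last by rewrite big_map -mpolyE.
move=> _ /mapP[m _ ->]; exists (wdeg m) => // m' /msuppZ_le.
by rewrite msuppX inE => /eqP ->.
Qed.

Lemma wcomp_indep (r : seq nat) (f : nat -> {mpoly K[n]}) : uniq r ->
  (forall d, wcomp d (f d)) -> \sum_(d <- r) f d = 0 ->
  forall d, d \in r -> f d = 0.
Proof.
move=> ur hf sf d dr; apply/mpolyP => m; rewrite mcoeff0.
apply: contra_eq sf; rewrite -mcoeff_msupp => mf.
apply/negP => /eqP /(congr1 (mcoeff m)).
rewrite mcoeff0 raddf_sum /= (bigD1_seq d) //= big1 => [|e ed].
  by rewrite addr0; apply/eqP; rewrite -mcoeff_msupp.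
apply: contraNeq ed; rewrite -mcoeff_msupp => me.
by rewrite -(hf _ _ me) (hf _ _ mf).
Qed.

Definition weighted_grading : grading {mpoly K[n]}.
Proof.
apply: (@Grading _ wcomp).
- by move=> d m; rewrite msupp0.
- by move=> d p q hp hq m /msuppB_le; rewrite mem_cat => /orP[/hp|/hq].
- move=> m; rewrite msupp1 inE => /eqP ->.
  by rewrite /wdeg big1 // => i _; rewrite mnm0E mul0n.
- move=> d e p q hp hq m /msuppM_le /allpairsP[[m1 m2] /= [/hp <- /hq <- ->]].
  exact: wdegD.
- exact: wcomp_span.
- exact: wcomp_indep.
Defined.

End WeightedPolynomials.

(* Main.v *)
(** In S^(e) let a, b, c, u be monomials of degree e with abc = u^3 such that ab,
    ac and bc have no other factorization into monomials of degree e.  Then no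
    quadratic relation of gr_m(S^(e)) involves the products ab, ac or bc, so that
    abc = u^3 is a minimal cubic relation and the resolution of K is not linear.
    For the weights 1, 4, 7, 9 of x, y, z, t and e = 9N + 21 this happens for
      a = x^3 t^(N+2), b = y^3 t^(N+1), c = z^3 t^N, u = xyz t^(N+1):
    only the factors x^3, y^3, z^3 of x^3 y^3, x^3 z^3, y^3 z^3 have degree 3 mod 9.
    Further variables are harmless, since they do not divide these monomials. *)

Require Import Defs.
From mathcomp Require Import all_boot all_algebra.
From mathcomp Require Import mpoly ring zify.

Set Implicit Arguments.
Unset Strict Implicit.
Unset Printing Implicit Defensive.

Import GRing.Theory.
Local Open Scope ring_scope.

(** * Obstruction to linearity from a pairing on the first two differentials *)

Section KoszulCriterion.
Variables (B : comNzRingType) (G : grading B) (R : comNzRingType).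
Variables (eps d : B -> R) (psi : B -> B -> R) (a b u v : B).
Hypotheses (epsD : {morph eps : x y / x + y}) (epsM : {morph eps : x y / x * y}).
Hypotheses (eps0 : eps 0 = 0) (eps1 : eps 1 = 1).
Hypothesis eps_irrelevant : forall x, x \in irrelevant G -> eps x = 0.
Hypotheses (dD : {morph d : x y / x + y}) (d0 : d 0 = 0) (da : d a = 1).
Hypothesis dM : forall x y, d (x * y) = eps x * d y + d x * eps y.
Hypotheses (psiD : forall x, {morph psi x : y z / y + z}) (psi0 : forall x, psi x 0 = 0).
Hypothesis psiCA : forall x y z, gcomp G 1 z -> psi x (y * z) = psi y (x * z).
Hypotheses (a_irr : a \in irrelevant G) (u_irr : u \in irrelevant G).
Hypotheses (abuv : a * b = u * v).
Hypothesis psi_abuv : forall x y z, psi x (b * y - v * z) = d x * eps y.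

(* If res_diff 0 sends ga to a t and gu to u t, where the augmentation sends t to 1
   modulo the irrelevant ideal, then b ga - v gu is a syzygy; the
   pairing with the columns of res_diff 0 given by psi vanishes on the multiples
   of linear syzygies, but not on this one. *)
Lemma not_koszul_criterion : ~ koszul G.
Proof.
move=> [F _ linF].
have lin i p q : gcomp G 1 (res_diff F i p q).
  have [->|/res_diff_homog[k degE hk]] := eqVneq (res_diff F i p q) 0; first exact: gcomp0.
  by have <- : k = 1%N by move: degE; rewrite !linF; lia.
move: (res_aug F) (res_diff F 0) (res_diff F 1) (@res_aug_surj _ _ F 1) (@res_aug_exact _ _ F)
  (@res_diff_exact _ _ F 0) (lin 0%N) (lin 1%N) => aug D0 D1 [t tE] exact0 exact1 lin0 lin1.
have gen_lift x : x \in irrelevant G -> exists g, x *: t = g *m D0.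
  by move=> x_irr; apply/exact0; rewrite -scalemxAl mxE mulrC; apply: idealMr.
have [[ga gaE] [gu guE]] := (gen_lift _ a_irr, gen_lift _ u_irr).
have [q sE] : exists q, b *: ga - v *: gu = q *m D1.
  apply/exact1; rewrite mulmxBl -!scalemxAl -gaE -guE !scalerA.
  by rewrite mulrC abuv mulrC subrr.
have D1D0 : D1 *m D0 = 0.
  apply/row_matrixP => l; rewrite row0 rowE mulmxA.
  by apply/exact1; exists (delta_mx 0 l).
have psi_sum x (I : Type) (r : seq I) (f : I -> B) :
    psi x (\sum_(i <- r) f i) = \sum_(i <- r) psi x (f i).
  by apply: (big_morph (psi x)) => [y z|]; [apply: psiD | apply: psi0].
have t0 j : eps (t 0 j) = 0.
  (* Apply [d] to the coordinate [j] of [a *: t = ga *m D0]: since [eps] kills [a] and the linear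
     entries of [D0], and [d a = 1], the left side becomes [eps (t 0 j)]. *)
  transitivity (\sum_p d (D0 p j) * eps (ga 0 p)).
    have := congr1 (fun M : 'M_(_, _) => d (M 0 j)) gaE.
    rewrite !mxE dM (eps_irrelevant a_irr) da mul0r add0r mul1r => ->.
    rewrite (big_morph d dD d0); apply: eq_bigr => p _.
    rewrite dM [eps (D0 p j)]eps_irrelevant ?mulr0 ?addr0 1?mulrC //.
    apply/irrelevantP; exists [:: D0 p j]; last by rewrite big_seq1.
    by move=> x; rewrite mem_seq1 => /eqP ->; exists 1%N.
  transitivity (\sum_p psi (D0 p j) ((b *: ga - v *: gu) 0 p)).
    by apply: eq_bigr => p _; rewrite -(psi_abuv _ _ (gu 0 p)) !mxE.
  (* The syzygy is [q *m D1]; as the entries of [D1] have degree 1, [psiCA] exchanges [D0 p j] with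
     [q 0 l], which assembles the product [D1 *m D0]. *)
  transitivity (\sum_l psi (q 0 l) ((D1 *m D0) l j)).
    under [RHS]eq_bigr => l _ do rewrite mxE psi_sum.
    rewrite exchange_big /=; apply: eq_bigr => p _.
    rewrite sE mxE psi_sum; apply: eq_bigr => l _.
    by rewrite psiCA 1?[D1 l p * _]mulrC.
  by rewrite D1D0 big1 // => l _; rewrite mxE.
(* Contradiction: 1 is an irrelevant element plus the augmentation of [t], and [eps] kills both. *)
have /eqP := eps1; rewrite -(subrK ((t *m aug) 0 0) 1).
rewrite epsD (eps_irrelevant tE) add0r mxE (big_morph eps epsD eps0).
by rewrite big1 ?(eq_sym 0) ?oner_eq0 // => j _; rewrite epsM t0 mul0r.
Qed.
End KoszulCriterion.

(** * Weighted degrees and sums over the divisors of a monomial *)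

Section Monomials.
Variables (n : nat) (w : 'I_n -> nat).
Implicit Types m : 'X_{1..n}.

Lemma wdeg0 : wdeg w 0%MM = 0%N.
Proof. by rewrite /wdeg big1 // => i _; rewrite mnm0E mul0n. Qed.

Lemma wdeg_eq0 m : (forall i, 0 < w i)%N -> (wdeg w m == 0%N) = (m == 0%MM).
Proof.
move=> w_gt0; apply/eqP/eqP => [m0|->]; last exact: wdeg0.
apply/mnmP => i; rewrite mnm0E.
move/eqP: m0; rewrite sum_nat_eq0 => /forallP/(_ i).
by rewrite muln_eq0 (gtn_eqF (w_gt0 i)) orbF => /eqP.
Qed.

Lemma submm m : (m - m = 0)%MM.
Proof. by apply/mnmP => i; rewrite mnmBE subnn mnm0E. Qed.

Lemma wdegB m m' : (m <= m')%MM -> (wdeg w m + wdeg w (m' - m)%MM)%N = wdeg w m'.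
Proof. by move=> le_m; rewrite addnC -wdegD submK. Qed.

(** Reduces the convolution sums for coefficients of products to short explicit lists. A divisor of
    [m] has total degree at most [mdeg m], so the bounded index type contains all of them. *)
Lemma big_submonomials (V : nmodType) m (s : seq 'X_{1..n}) (F : 'X_{1..n} -> V) :
  uniq s -> all (fun m' => m' <= m)%MM s ->
  (forall m', (m' <= m)%MM -> m' \notin s -> F m' = 0) ->
  \sum_(k : 'X_{1..n < (mdeg m).+1} | (k <= m)%MM) F k = \sum_(m' <- s) F m'.
Proof.
move=> us sm F0; rewrite -big_filter -(big_map (@bmnm _ _) predT F).
set r := map _ _; have ur : uniq r.
  by rewrite map_inj_uniq ?filter_uniq ?index_enum_uniq //; apply: val_inj.
have rE m' : (m' \in r) = (m' <= m)%MM.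
  apply/mapP/idP => [[k] | le_m]; first by rewrite mem_filter => /andP[? _] ->.
  have lt_m : (mdeg m' < (mdeg m).+1)%N.
    by rewrite ltnS !mdegE leq_sum // => i _; apply: (mnm_lepP le_m).
  by exists (BMultinom lt_m); rewrite // mem_filter /= le_m mem_index_enum.
rewrite (bigID (mem s)) /= [X in _ + X]big1_seq => [|m' /andP[m's]]; last first.
  by rewrite rE => /F0; apply.
rewrite addr0 -big_filter; apply: perm_big; apply: uniq_perm => // [|m'].
  exact: filter_uniq.
by rewrite mem_filter rE; apply: andb_idr => /(allP sm).
Qed.

Lemma mcoeffM_submonomials (R : nzRingType) (p q : {mpoly R[n]}) m :
  (p * q)@_m =
    \sum_(k : 'X_{1..n < (mdeg m).+1} | (k <= m)%MM) p@_k * q@_(m - k).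
Proof. by rewrite -(mcoeff_poly_mul_lin _ _ (ltnSn (mdeg m))). Qed.

End Monomials.

(** * Coefficients of elements of the associated graded ring *)

Section GrCoef.
Variables (K : fieldType) (n : nat) (w : 'I_n -> nat) (e : nat).
Hypothesis e_gt0 : (0 < e)%N.

Local Notation A := (veronese (weighted_grading K w) e).
Local Notation AG := (veronese_grading (weighted_grading K w) e_gt0).
Local Notation I := (irrelevant AG : idealr A).
Local Notation B := (assoc_gr I).
Local Notation BG := (gr_grading I).
Local Notation Ipow := (ideal_pow (fun x : A => x \in I)).

Implicit Types (m : 'X_{1..n}) (x y z : B).

Lemma veronese_wdeg (P : A) m : m \in msupp (val P) -> (e %| wdeg w m)%N.
Proof.
have [s hs ->] := veroneseP _ _ _ (valP P).
rewrite mcoeff_msupp (raddf_sum (mcoeff m)) => /eqP; apply: contra_notT => edvd.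
rewrite big_seq big1 // => x /hs[d ed hd]; apply/eqP.
rewrite mcoeff_eq0; apply: contra edvd => /hd; by move->.
Qed.

(** Monomials of elements of the irrelevant ideal have degree at least [e], and degrees add up in
    products. This compares the ideal-adic filtration with the filtration by degree. *)
Lemma ideal_pow_wdeg k (P : A) m :
  Ipow k P -> m \in msupp (val P) -> (e * k <= wdeg w m)%N.
Proof.
elim: k P m => [|k IHk] P m; first by rewrite muln0.
move=> [s hs ->]; rewrite mcoeff_msupp (raddf_sum (val : A -> _)) (raddf_sum (mcoeff m)) => /eqP.
apply: contra_notT; rewrite -ltnNge => lt_m; rewrite big_seq big1 // => xy xys.
have {hs xys} [/irrelevantP[t ht ->] hy] := hs _ xys.
rewrite mulr_suml (raddf_sum (val : A -> _)) (raddf_sum (mcoeff m)) big_seq big1 // => z zt.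
have {ht zt} [d d_gt0 hz] := ht _ zt.
apply/eqP; rewrite mcoeff_eq0; apply: contraL lt_m => /msuppM_le.
move=> /allpairsP[[m1 m2] /= [/hz m1E /(IHk _ _ hy) le_m2 ->]].
rewrite -leqNgt wdegD m1E mulnS leq_add //.
by rewrite leq_pmulr.
Qed.

(* The coefficients of the image of x under the ring morphism from gr_m(A) to the
   associated graded ring of the filtration of A by degree, which is A itself:
   the class of P t^k is mapped to the component of degree e * k of P. *)
Definition gr_coef x m : K :=
  (val ((rees_val (repr x))`_(wdeg w m %/ e)) : {mpoly K[n]})@_m.

(** Two representatives differ by an element of [rees_ideal]; with [k = wdeg w m %/ e], its
    coefficient of index [k] has only monomials of degree at least [e * (k + 1)], so [m] is not
    among them. *)
Lemma gr_coef_pi (p : rees I) m :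
  gr_coef (gr_pi p) m = (val ((rees_val p)`_(wdeg w m %/ e)) : {mpoly K[n]})@_m.
Proof.
have /gr_pi_eq0/rees_idealP/(_ (wdeg w m %/ e)%N) : gr_pi (repr (gr_pi p) - p) = 0.
  by rewrite /gr_pi rmorphB /= reprK subrr.
move=> /(@ideal_pow_wdeg _ _ m); rewrite [rees_val _]/= coefB [val _]/= => h.
apply/eqP; rewrite -subr_eq0 /gr_coef -(raddfB (mcoeff m)) mcoeff_eq0.
by apply/negP => /h; rewrite leqNgt mulnC ltn_ceil.
Qed.

Lemma gr_coefD m x y : gr_coef (x + y) m = gr_coef x m + gr_coef y m.
Proof.
rewrite -[x]reprK -[y]reprK -rmorphD /=.
by rewrite -!/(gr_pi _) !gr_coef_pi /= coefD /= raddfD.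
Qed.

Lemma gr_coef0 m : gr_coef 0 m = 0.
Proof. by apply: (addrI (gr_coef 0 m)); rewrite -gr_coefD !addr0. Qed.

Lemma gr_coef_sum (T : Type) (r : seq T) (P : pred T) (F : T -> B) m :
  gr_coef (\sum_(i <- r | P i) F i) m = \sum_(i <- r | P i) gr_coef (F i) m.
Proof.
by apply: (big_morph (gr_coef^~ m)); [apply: gr_coefD | apply: gr_coef0].
Qed.

Lemma gr_coefN x m : gr_coef (- x) m = - gr_coef x m.
Proof. by apply/eqP; rewrite -addr_eq0 -gr_coefD addNr gr_coef0. Qed.

Lemma gr_coef_ndvd x m : ~~ (e %| wdeg w m)%N -> gr_coef x m = 0.
Proof.
by move=> ndvd; apply/eqP; rewrite mcoeff_eq0; apply: contra ndvd; apply: veronese_wdeg.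
Qed.

Lemma gr_coefM x y m :
  gr_coef (x * y) m =
    \sum_(k : 'X_{1..n < (mdeg m).+1} | (k <= m)%MM)
      gr_coef x k * gr_coef y (m - k)%MM.
Proof.
rewrite -[x]reprK -[y]reprK -rmorphM /= -!/(gr_pi _).
set p := repr x; set q := repr y; rewrite gr_coef_pi.
(* The division by [e] in [gr_coef] rounds down, so degrees outside the multiples of [e] are treated
   apart: there both sides vanish. *)
have [edvd|ndvd] := boolP (e %| wdeg w m)%N; last first.
  transitivity (0 : K).
    apply/eqP; rewrite mcoeff_eq0; apply: contra ndvd.
    exact: veronese_wdeg.
  rewrite big1 // => k le_k.
  have [ek|/gr_coef_ndvd-> //] := boolP (e %| wdeg w k)%N; last by rewrite mul0r.
  rewrite [X in _ * X]gr_coef_ndvd ?mulr0 //; apply: contra ndvd => emk.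
  by rewrite -(wdegB w le_k) dvdn_add.
rewrite [rees_val _]/= coefM (raddf_sum (val : A -> _)) (raddf_sum (mcoeff m)) /=.
under eq_bigr => i _ do rewrite mcoeffM_submonomials.
rewrite exchange_big /=; apply: eq_bigr => k le_k.
have := wdegB w le_k; move: edvd; rewrite !gr_coef_pi.
set k' := (m - k)%MM => /dvdnP[c ->].
have [/dvdnP[a kE]|ndk _] := boolP (e %| wdeg w k)%N; last first.
  have F0 (P : A) : (val P : {mpoly K[n]})@_k = 0.
    by apply/eqP; rewrite mcoeff_eq0; apply: contra ndk; apply: veronese_wdeg.
  by rewrite F0 mul0r big1 // => i _; rewrite F0 mul0r.
rewrite kE => cE; have le_ac : (a <= c)%N by rewrite -(leq_pmul2r e_gt0) -cE leq_addr.
have k'E : wdeg w k' = ((c - a) * e)%N by rewrite mulnBl -cE addKn.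
(* Only the index [a] contributes: by [ideal_pow_wdeg], the degree of [k'] is too small for the
   second factor if [i < a], and that of [k] for the first if [i > a]. *)
rewrite k'E !mulnK // (bigD1 (Ordinal (le_ac : a < c.+1)%N)) //= big1 ?addr0 // => i.
rewrite -val_eqE neq_ltn /= => /orP[lt_i | lt_i].
  rewrite [X in _ * X](_ : _ = 0) ?mulr0 //; apply/eqP; rewrite mcoeff_eq0.
  apply/negP => /(ideal_pow_wdeg (reesP _ _ (rees_valP q) _)).
  by rewrite k'E mulnC leq_pmul2r // leqNgt ltn_sub2l // (leq_trans lt_i).
rewrite [X in X * _](_ : _ = 0) ?mul0r //; apply/eqP; rewrite mcoeff_eq0.
apply/negP => /(ideal_pow_wdeg (reesP _ _ (rees_valP p) _)).
by rewrite kE mulnC leq_pmul2r // leqNgt lt_i.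
Qed.

Lemma gr_coef_comp k x m : gcomp BG k x -> gr_coef x m != 0 -> wdeg w m = (e * k)%N.
Proof.
move=> [p hp ->]; have [edvd|/gr_coef_ndvd->] := boolP (e %| wdeg w m)%N; last first.
  by rewrite eqxx.
rewrite gr_coef_pi; have [<- _|/hp->] := eqVneq (wdeg w m %/ e)%N k.
  by rewrite mulnC divnK.
by rewrite mcoeff0 eqxx.
Qed.

Lemma gr_coef_irrelevant x : x \in irrelevant BG -> gr_coef x 0%MM = 0.
Proof.
move=> /irrelevantP[s hs ->]; rewrite gr_coef_sum big_seq big1 // => y /hs[k k_gt0 hy].
apply: contraTeq k_gt0 => /(gr_coef_comp hy)/eqP.
by rewrite wdeg0 eq_sym muln_eq0 (gtn_eqF e_gt0) -eqn0Ngt.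
Qed.

Lemma gr_coef1 : gr_coef 1 0%MM = 1.
Proof.
have -> : 1 = gr_pi (1 : rees I) by rewrite /gr_pi rmorph1.
by rewrite gr_coef_pi wdeg0 div0n [rees_val _]/= coef1 [val _]/= mcoeff1 eqxx.
Qed.

(** * Degree-one classes of the monomials of degree [e] *)

Section Generator.
Variable m : 'X_{1..n}.
Hypothesis m_deg : wdeg w m = e.

Lemma gen_veronese : 'X_[m] \in veronese_pred (weighted_grading K w) e.
Proof.
apply/veroneseP; exists [:: 'X_[m]]; last by rewrite big_seq1.
move=> p /[!inE]/eqP ->; exists e => // m'.
by rewrite msuppX inE => /eqP ->.
Qed.

Definition veronese_gen : A := Veronese gen_veronese.

Lemma veronese_gen_irrelevant : veronese_gen \in I.
Proof.
apply/irrelevantP; exists [:: veronese_gen]; last by rewrite big_seq1.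
move=> p /[!inE]/eqP ->; exists 1%N => // m'.
by rewrite muln1 msuppX inE => /eqP ->.
Qed.

Lemma gen_rees : veronese_gen *: 'X \in rees_pred I.
Proof.
apply/reesP => k; rewrite coefZ coefX; case: eqP => [->|_]; last first.
  by rewrite mulr0; apply: ideal_pow0.
exists [:: (veronese_gen, 1)]; last by rewrite big_seq1.
by move=> p; rewrite mem_seq1 => /eqP ->; split=> //; apply: veronese_gen_irrelevant.
Qed.

Definition gr_gen : B := gr_pi (Rees gen_rees).

Lemma gr_gen_comp : gcomp BG 1 gr_gen.
Proof.
exists (Rees gen_rees) => // j /negPf j1.
by rewrite /= coefZ coefX j1 mulr0.
Qed.

Lemma gr_gen_irrelevant : gr_gen \in irrelevant BG.
Proof.
apply/irrelevantP; exists [:: gr_gen]; last by rewrite big_seq1.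
move=> x /[!inE]/eqP ->; exists 1%N => //; exact: gr_gen_comp.
Qed.

Lemma gr_coef_gen m' : gr_coef gr_gen m' = (m == m')%:R.
Proof.
have [deg_m'|deg_m'] := eqVneq (wdeg w m') e.
  rewrite gr_coef_pi deg_m' divnn e_gt0 /= coefZ coefX mulr1.
  exact: mcoeffX.
transitivity (0 : K).
  apply: contraNeq deg_m' => /(gr_coef_comp gr_gen_comp) ->.
  by rewrite muln1.
by case: (eqVneq m m') deg_m' => // <-; rewrite m_deg eqxx.
Qed.

End Generator.

(** * The cubic relation and the pairing that detects it *)

Section CubicRelation.
Hypothesis w_gt0 : forall i, (0 < w i)%N.

Lemma gr_coefM0 x y :
  gr_coef (x * y) 0%MM = gr_coef x 0%MM * gr_coef y 0%MM.
Proof.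
rewrite gr_coefM (@big_submonomials n _ _ [:: 0%MM]
  (fun k => gr_coef x k * gr_coef y (0 - k)%MM)) ?big_seq1 ?subm0 //.
- by rewrite /= lepm_refl.
- move=> m /mnm_lepP m_le0; rewrite inE => /eqP[]; apply/mnmP => i.
  by have := m_le0 i; rewrite mnm0E leqn0 => /eqP.
Qed.

(** The only divisors of [a] of degree divisible by [e] are 1 and [a]. Thus the coefficient at [a]
    is a derivation over the constant coefficient, as the criterion asks of [d]. *)
Lemma gr_coefM_gen x y a : wdeg w a = e ->
  gr_coef (x * y) a = gr_coef x 0%MM * gr_coef y a + gr_coef x a * gr_coef y 0%MM.
Proof.
move=> aE; have a0 : a != 0%MM by rewrite -(wdeg_eq0 _ w_gt0) aE -lt0n.
rewrite gr_coefM (@big_submonomials n _ _ [:: 0%MM; a]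
  (fun k => gr_coef x k * gr_coef y (a - k)%MM)).
- by rewrite big_cons big_seq1 subm0 submm.
- by rewrite /= inE eq_sym a0.
- by rewrite /= lepm_refl; apply/andP; split=> //; apply/mnm_lepP => i; rewrite mnm0E.
move=> m le_m; rewrite !inE negb_or => /andP[m0 ma].
have [/dvdnP[k mE]|/gr_coef_ndvd-> //] := boolP (e %| wdeg w m)%N; last by rewrite mul0r.
have := wdegB w le_m; rewrite aE mE => kE.
case: k kE mE => [|[|k]] kE mE; last by lia.
- by move/eqP: mE; rewrite mul0n wdeg_eq0 // (negPf m0).
- have /eqP : wdeg w (a - m)%MM = 0%N by lia.
  by rewrite wdeg_eq0 // => /eqP am; move: (submK le_m) ma; rewrite am add0m => -> /[!eqxx].
Qed.

Definition unique_factorization (a b : 'X_{1..n}) :=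
  forall m, (m <= a + b)%MM -> wdeg w m = e -> m \in [:: a; b].

(** The divisors of [ab] of degree divisible by [e] are 1, [a], [b] and [ab]; [a != b] keeps this
    list free of repetitions. *)
Lemma gr_coefM_gen2 x y a b : wdeg w a = e -> wdeg w b = e -> a != b ->
  unique_factorization a b ->
  gr_coef (x * y) (a + b)%MM =
    gr_coef x a * gr_coef y b + gr_coef x b * gr_coef y a
      + gr_coef x 0%MM * gr_coef y (a + b)%MM
      + gr_coef x (a + b)%MM * gr_coef y 0%MM.
Proof.
move=> aE bE neq_ab ab_uniq; have abE : wdeg w (a + b) = (2 * e)%N by rewrite wdegD; lia.
have neq m m' : wdeg w m <> wdeg w m' -> m == m' = false.
  by move=> h; apply/eqP => mm'; apply: h; rewrite mm'.
rewrite gr_coefM (@big_submonomials n _ _ [:: a; b; 0; a + b]%MM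
  (fun k => gr_coef x k * gr_coef y (a + b - k)%MM)).
- rewrite !big_cons big_nil subm0 submm addr0 !addrA.
  congr (_ * gr_coef _ _ + _ * gr_coef _ _ + _ + _).
    by rewrite addmC addmK.
  by rewrite addmK.
- rewrite /= !inE (negPf neq_ab) !neq //; by rewrite ?abE ?aE ?bE ?wdeg0; lia.
- rewrite /= lepm_refl lem_addr lem_addl /= andbT.
  by apply/mnm_lepP => i; rewrite mnm0E.
move=> m le_m ms.
have [/dvdnP[k mE]|/gr_coef_ndvd-> //] := boolP (e %| wdeg w m)%N; last by rewrite mul0r.
have := wdegB w le_m; rewrite abE mE => kE.
case: k kE mE => [|[|[|k]]] kE mE; last by lia.
- by move/eqP: mE ms; rewrite mul0n wdeg_eq0 // => /eqP ->; rewrite !inE eqxx !orbT.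
- have := ab_uniq m le_m; rewrite mE mul1n => /(_ erefl) m_ab.
  by move: ms m_ab; rewrite !inE => /norP[/negPf-> /norP[/negPf->]].
- have /eqP : wdeg w (a + b - m)%MM = 0%N by lia.
  rewrite wdeg_eq0 // => /eqP am; move: (submK le_m) ms; rewrite am add0m => ->.
  by rewrite !inE eqxx !orbT.
Qed.

Variables a b c u : 'X_{1..n}.
Hypotheses (aE : wdeg w a = e) (bE : wdeg w b = e) (cE : wdeg w c = e).
Hypothesis uE : wdeg w u = e.
Hypothesis abcu_uniq : uniq [:: a; b; c; u].
Hypothesis abc_u : (a + b + c = u + u + u)%MM.
Hypotheses (ab_uniq : unique_factorization a b) (ac_uniq : unique_factorization a c).
Hypothesis bc_uniq : unique_factorization b c.

(** Bracketed as the identity [a * b = u * v] of the criterion, with [bc] for its [b] and the square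
    of [u] for its [v]. *)
Lemma gr_relation :
  gr_gen aE * (gr_gen bE * gr_gen cE) = gr_gen uE * (gr_gen uE * gr_gen uE).
Proof.
rewrite /gr_gen /gr_pi -!rmorphM /=; congr (_ _); apply: val_inj => /=.
rewrite -!scalerAl -!scalerAr !scalerA; congr (_ *: _).
by apply: val_inj; rewrite /= -!mpolyXD addmA abc_u !addmA.
Qed.

(* Its value at (x, y z), for x, y, z of degree 1, is the permanent of their
   coefficients at a, b, c: the coefficient of abc in the ring defined by the
   quadratic relations of gr, where abc and u^3 are distinct. *)
Definition abc_form x y : K :=
  gr_coef x a * gr_coef y (b + c)%MM + gr_coef x b * gr_coef y (a + c)%MM
    + gr_coef x c * gr_coef y (a + b)%MM.

Lemma abc_formD x y z : abc_form x (y + z) = abc_form x y + abc_form x z.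
Proof. by rewrite /abc_form !gr_coefD; ring. Qed.

Lemma abc_form0 x : abc_form x 0 = 0.
Proof. by rewrite /abc_form !gr_coef0 !mulr0 !addr0. Qed.

Lemma gr1_coef0 z m : gcomp BG 1 z -> wdeg w m != e -> gr_coef z m = 0.
Proof.
by move=> hz; apply: contraNeq => /(gr_coef_comp hz) ->; rewrite muln1.
Qed.

(** As [z] has no coefficient at 1, [ab], [ac] or [bc], expanding gives the permanent for arbitrary
    [x] and [y], which is symmetric. *)
Lemma abc_formCA x y z : gcomp BG 1 z -> abc_form x (y * z) = abc_form y (x * z).
Proof.
move=> hz; have [neq_ab neq_ac neq_bc] : [/\ a != b, a != c & b != c].
  by move: abcu_uniq; rewrite /= !inE !negb_or => /and4P[/and3P[-> -> _] /andP[-> _]].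
have z0 : gr_coef z 0%MM = 0 by rewrite (gr1_coef0 hz) // wdeg0; lia.
have z2 m m' : wdeg w m = e -> wdeg w m' = e -> gr_coef z (m + m')%MM = 0.
  by move=> mE m'E; rewrite (gr1_coef0 hz) // wdegD; lia.
by rewrite /abc_form !gr_coefM_gen2 // z0 !z2 //; ring.
Qed.

Lemma gr_gen2_comp m m' (mE : wdeg w m = e) (m'E : wdeg w m' = e) :
  gcomp BG 2 (gr_gen mE * gr_gen m'E).
Proof. exact: (gcompM (gr_gen_comp mE) (gr_gen_comp m'E)). Qed.

(** Here the two sides of the cubic relation are told apart: among [ab], [ac] and [bc], the product
    of the generators at [b] and [c] meets only [bc], and the square of the one at [u] meets
    none. *)
Lemma abc_form_relation x y z :
  abc_form x (gr_gen bE * gr_gen cE * y - gr_gen uE * gr_gen uE * z) =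
  gr_coef x a * gr_coef y 0%MM.
Proof.
have [[neq_ab neq_ac neq_au] [neq_bc neq_bu neq_cu]] :
    [/\ a != b, a != c & a != u] /\ [/\ b != c, b != u & c != u].
  by move: abcu_uniq; rewrite /= !inE !negb_or => /and4P[/and3P[-> -> ->] /andP[-> ->] ->].
have coef0 m m' (mE : wdeg w m = e) (m'E : wdeg w m' = e) m1 :
    wdeg w m1 != (e * 2)%N -> gr_coef (gr_gen mE * gr_gen m'E) m1 = 0.
  by apply: contraNeq => /(gr_coef_comp (gr_gen2_comp mE m'E)) ->.
have [neq1 neq0] : (e != e * 2)%N /\ (0 != e * 2)%N by lia.
(* The product of two generators lies in degree [2e], so only the constant coefficient of [x']
   enters. *)
have coefM x' m m' m1 m2 (mE : wdeg w m = e) (m'E : wdeg w m' = e) :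
    wdeg w m1 = e -> wdeg w m2 = e -> m1 != m2 -> unique_factorization m1 m2 ->
    gr_coef (gr_gen mE * gr_gen m'E * x') (m1 + m2)%MM =
    ((m == m1) && (m' == m2) || (m == m2) && (m' == m1))%:R * gr_coef x' 0%MM.
  move=> m1E m2E neq12 m12_uniq; rewrite gr_coefM_gen2 //.
  rewrite (coef0 _ _ _ _ m1) ?m1E // (coef0 _ _ _ _ m2) ?m2E // (coef0 _ _ _ _ 0%MM) ?wdeg0 //.
  rewrite !mul0r !add0r; congr (_ * _); rewrite gr_coefM_gen2 // !gr_coef_gen.
  rewrite -![_ == 0%MM](wdeg_eq0 _ w_gt0) mE m'E (gtn_eqF e_gt0) mul0r mulr0 !addr0.
  have [->|_] := eqVneq m m1; first by rewrite (negPf neq12) mul1r mul0r addr0 orbF.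
  by rewrite mul0r add0r -natrM mulnb.
rewrite /abc_form !gr_coefD !gr_coefN !coefM // !eqxx.
rewrite ![u == _]eq_sym ![b == a]eq_sym ![c == a]eq_sym.
rewrite (negPf neq_ab) (negPf neq_ac) (negPf neq_au).
rewrite (negPf neq_bc) (negPf neq_bu) (negPf neq_cu) /=.
by rewrite !(mul0r, mul1r, subr0, mulr0, addr0).
Qed.

Lemma gr_not_koszul : ~ koszul BG.
Proof.
apply: (@not_koszul_criterion B BG K (gr_coef^~ 0%MM) (gr_coef^~ a) abc_form
  (gr_gen aE) (gr_gen bE * gr_gen cE) (gr_gen uE) (gr_gen uE * gr_gen uE)).
- exact: gr_coefD.
- exact: gr_coefM0.
- exact: gr_coef0.
- exact: gr_coef1.
- exact: gr_coef_irrelevant.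
- exact: gr_coefD.
- exact: gr_coef0.
- by rewrite gr_coef_gen eqxx.
- by move=> x y; apply: gr_coefM_gen.
- exact: abc_formD.
- exact: abc_form0.
- exact: abc_formCA.
- exact: gr_gen_irrelevant.
- exact: gr_gen_irrelevant.
- exact: gr_relation.
- exact: abc_form_relation.
Qed.

End CubicRelation.
End GrCoef.

(** * Monomials in the first four variables, of weights 1, 4, 7, 9 *)

Section Example.
Variables (n : nat).
Hypothesis n_ge4 : (4 <= n)%N.

(** The default value 1 is the weight of all further variables. *)
Definition example_weight (i : 'I_n) : nat := nth 1%N [:: 1; 4; 7; 9]%N i.

Definition mono4 (i j k l : nat) : 'X_{1..n} :=
  [multinom nth 0%N [:: i; j; k; l] h | h < n].

Lemma wdeg_mono4 i j k l :
  wdeg example_weight (mono4 i j k l) = (i + 4 * j + 7 * k + 9 * l)%N.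
Proof.
rewrite /wdeg (eq_bigr (fun h : 'I_n =>
  nth 0 [:: i; j; k; l] h * nth 1 [:: 1; 4; 7; 9] h)%N) => [|h _]; last by rewrite mnmE.
rewrite -(big_mkord xpredT (fun h => nth 0 [:: i; j; k; l] h * nth 1 [:: 1; 4; 7; 9] h)%N).
rewrite (@big_cat_nat _ _ _ 4) //= [X in (_ + X)%N]big_nat_cond.
rewrite [X in (_ + X)%N]big1 => [|h /andP[/andP[h4 _] _]]; last by rewrite nth_default.
by rewrite unlock /= /index_iota /=; lia.
Qed.

Lemma mono4D i j k l i' j' k' l' :
  (mono4 i j k l + mono4 i' j' k' l')%MM = mono4 (i + i') (j + j') (k + k') (l + l').
Proof.
apply/mnmP => h; rewrite mnmDE !mnmE.
by case: h => -[|[|[|[|h]]]] ? //=; rewrite !nth_nil.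
Qed.

Lemma mono4_le m i j k l : (m <= mono4 i j k l)%MM ->
  exists i' j' k' l', [/\ (i' <= i)%N, (j' <= j)%N, (k' <= k)%N, (l' <= l)%N
    & m = mono4 i' j' k' l'].
Proof.
move=> /mnm_lepP le_m; pose co h (lt_h : (h < 4)%N) := m (Ordinal (leq_trans lt_h n_ge4)).
exists (co 0%N isT), (co 1%N isT), (co 2%N isT), (co 3%N isT).
split; try by rewrite /co (leq_trans (le_m _)) // mnmE.
apply/mnmP => h; rewrite mnmE; have := le_m h; rewrite mnmE.
case: h => -[|[|[|[|h]]]] lt_h /= le_mh; rewrite ?nth_nil /co; try by congr (m _); apply: val_inj.
by move: le_mh; rewrite nth_nil leqn0 => /eqP.
Qed.

Lemma mono4_inj i j k l i' j' k' l' : mono4 i j k l = mono4 i' j' k' l' ->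
  [/\ i = i', j = j', k = k' & l = l'].
Proof.
move=> eq_m; have eq_h h (lt_h : (h < 4)%N) :
    nth 0%N [:: i; j; k; l] h = nth 0%N [:: i'; j'; k'; l'] h.
  by have := congr1 (fun m : 'X_{1..n} => m (Ordinal (leq_trans lt_h n_ge4))) eq_m;
    rewrite !mnmE.
by split; [have := eq_h 0%N isT | have := eq_h 1%N isT | have := eq_h 2%N isT
  | have := eq_h 3%N isT].
Qed.

End Example.

Local Close Scope ring_scope.

Theorem corollary2 (K : fieldType) (n : nat) (hn : 4 <= n) :
  exists2 w : 'I_n -> nat, (forall i, 0 < w i)
    & forall N : nat, exists (e : nat) (e_gt0 : 0 < e),
        N <= e /\
        ~ nonstandard_koszul (veronese_grading (weighted_grading K w) e_gt0).
Proof.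
have w_gt0 (i : 'I_n) : (0 < example_weight i)%N.
  by case: i => -[|[|[|[|h]]]] ?; rewrite /example_weight //= nth_nil.
exists (@example_weight n) => // N.
have e_gt0 : (0 < 9 * N + 21)%N by lia.
exists (9 * N + 21)%N, e_gt0; split; first by lia.
have mem2 (m m1 m2 : 'X_{1..n}) : m = m1 \/ m = m2 -> m \in [:: m1; m2].
  by case=> ->; rewrite !inE eqxx ?orbT.
apply: (@gr_not_koszul K n _ _ e_gt0 w_gt0 (mono4 n 3 0 0 N.+2) (mono4 n 0 3 0 N.+1)
  (mono4 n 0 0 3 N) (mono4 n 1 1 1 N.+1)); rewrite ?(wdeg_mono4 hn) //; try lia.
- have neq i j k l i' j' k' l' : (i, j, k, l) != (i', j', k', l') ->
      mono4 n i j k l != mono4 n i' j' k' l'.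
    by apply: contraNneq => /(mono4_inj hn)[-> -> -> ->].
  by rewrite /= !inE !negb_or !neq.
- by rewrite !mono4D; congr mono4; lia.
- move=> m; rewrite mono4D => /(mono4_le hn)[i [j [k [l [? ? ? ? ->]]]]].
  rewrite (wdeg_mono4 hn) => degE; apply: mem2.
  (* Modulo 9, [degE] reads [i + 4 * j = 3] with [i] and [j] at most 3, which leaves [(3, 0)] and
     [(0, 3)]; then the degree determines [l]. The other two pairs are similar. *)
  have [[-> [-> [-> ->]]]|[-> [-> [-> ->]]]] :
    (i = 3 /\ j = 0 /\ k = 0 /\ l = N.+2)%N \/ (i = 0 /\ j = 3 /\ k = 0 /\ l = N.+1)%N by lia.
  + by left.
  + by right.
- move=> m; rewrite mono4D => /(mono4_le hn)[i [j [k [l [? ? ? ? ->]]]]].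
  rewrite (wdeg_mono4 hn) => degE; apply: mem2.
  have [[-> [-> [-> ->]]]|[-> [-> [-> ->]]]] :
    (i = 3 /\ j = 0 /\ k = 0 /\ l = N.+2)%N \/ (i = 0 /\ j = 0 /\ k = 3 /\ l = N)%N by lia.
  + by left.
  + by right.
- move=> m; rewrite mono4D => /(mono4_le hn)[i [j [k [l [? ? ? ? ->]]]]].
  rewrite (wdeg_mono4 hn) => degE; apply: mem2.
  have [[-> [-> [-> ->]]]|[-> [-> [-> ->]]]] :
    (i = 0 /\ j = 3 /\ k = 0 /\ l = N.+1)%N \/ (i = 0 /\ j = 0 /\ k = 3 /\ l = N)%N by lia.
  + by left.
  + by right.
Qed.
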